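(* Let $q$ be a prime power and let $\mathcal{C}$ be an $[n,k]$ linear code over $\mathbb{F}_q$ with $d(\mathcal{C}^\perp)\geq 2$ and diameter $\delta$. Then $$n\leq \begin{cases} \frac{q}{q-1}\delta-1, & \text{if } (q-1)\mid\delta,\\ \left\lfloor\frac{q}{q-1}\delta\right\rfloor, & \text{otherwise.}\end{cases}$$ In particular, for a binary code ($q=2$) the inequality $n\leq 2\delta-1$ holds. Moreover, given $n$ and $\delta$, the dimension $k$ satisfies $$k\geq \log_q\left(\frac{\delta}{\delta-n\left(1-\frac{1}{q}\right)}\right).$$
   Context: An $[n,k]$ linear code over $\mathbb{F}_q$ (with $n$ a positive integer) is a $k$-dimensional $\mathbb{F}_q$-subspace $\mathcal{C}$ of $\mathbb{F}_q^n$. The Hamming weight $\mathrm{wt}(\mathbf{c})$ is the number of nonzero coordinates of $\mathbf{c}$. The diameter of $\mathcal{C}$ is its maximum weight, $\delta=\delta(\mathcal{C})=\max\{\mathrm{wt}(\mathbf{c}) : \mathbf{c}\in\mathcal{C}\}$. The dual code is $\mathcal{C}^\perp=\{\mathbf{x}\in\mathbb{F}_q^n : \sum_{i}x_ic_i=0 \text{ for all } \mathbf{c}\in\mathcal{C}\}$. The condition $d(\mathcal{C}^\perp)\ge 2$ means that $\mathcal{C}^\perp$ contains no vector of weight $1$; equivalently, a generator matrix of $\mathcal{C}$ (a $k\times n$ matrix whose rows form a basis of $\mathcal{C}$) has no zero column. *)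

(* Defs.v *)
From HB Require Import structures.
From mathcomp Require Import all_boot all_order all_algebra.
From mathcomp Require Import all_classical all_reals all_analysis.

Set Implicit Arguments.
Unset Strict Implicit.
Unset Printing Implicit Defensive.

Import Order.TTheory GRing.Theory Num.Theory.
Local Open Scope ring_scope.

Definition wt (F : finFieldType) (n : nat) (c : 'rV[F]_n) : nat :=
  #|[set i : 'I_n | c ord0 i != 0]|.

Definition diameter (F : finFieldType) (n : nat) (C : {vspace 'rV[F]_n}) : nat :=
  (\max_(c : 'rV[F]_n | c \in C) wt c)%N.

Definition dual_code (F : finFieldType) (n : nat) (C : {vspace 'rV[F]_n}) :
    {set 'rV[F]_n} :=
  [set x : 'rV[F]_n |
    [forall c : 'rV[F]_n, (c \in C) ==> (\sum_(i < n) x ord0 i * c ord0 i == 0)]].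

(* The zero vector has no bearing on the minimum distance, so d(C^perp) >= 2
   says exactly that weight 1 does not occur; it holds when C^perp = {0}. *)
Definition dual_distance_ge2 (F : finFieldType) (n : nat)
    (C : {vspace 'rV[F]_n}) : Prop :=
  forall x : 'rV[F]_n, x \in dual_code C -> wt x <> 1%N.

(* Like [ln], this is 0 for x <= 0. *)
Definition logb (R : realType) (b x : R) : R := ln x / ln b.

(* Main.v *)
(* Count the pairs (c, i) with c in C and c_i <> 0. Since d(C^perp) >= 2, no
   coordinate vanishes identically on C, so each coordinate takes every value
   of F equally often and the count is n |C| (q - 1) / q. On the other hand it
   is at most delta (|C| - 1), as the zero word contributes nothing. With
   |C| = q^k this Plotkin-type inequality gives all three bounds. *)
Require Import Defs.
From HB Require Import structures.
From mathcomp Require Import all_boot all_order all_algebra finfield.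
From mathcomp Require Import zify ring.
From mathcomp Require Import all_classical all_reals all_analysis.

Set Implicit Arguments.
Unset Strict Implicit.
Unset Printing Implicit Defensive.

Import Order.TTheory GRing.Theory Num.Theory.
Local Open Scope ring_scope.

Section WeightCount.
Variables (F : finFieldType) (n : nat).
Implicit Types (C : {vspace 'rV[F]_n}) (c : 'rV[F]_n) (i : 'I_n).

Lemma wtE c : wt c = (\sum_(i < n) (c ord0 i != 0%R))%N.
Proof.
by rewrite /wt -sum1_card big_mkcond; apply: eq_bigr => i _; rewrite inE; case: ifP.
Qed.

Lemma wt0 : wt (0 : 'rV[F]_n) = 0%N.
Proof. by rewrite wtE big1 // => i _; rewrite mxE eqxx. Qed.

Lemma wt_le_diameter C c : c \in C -> (wt c <= diameter C)%N.
Proof. by move=> Cc; rewrite /diameter (leq_bigmax_cond (P := mem C)). Qed.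

(** Otherwise the unit vector at [i] would be orthogonal to all of [C], a dual word of weight 1. *)
Lemma dual_distance_ge2_coord C i :
  dual_distance_ge2 C -> exists2 c, c \in C & c ord0 i != 0.
Proof.
move=> dC; pose e : 'rV[F]_n := delta_mx ord0 i.
have wt_e : wt e = 1%N.
  rewrite wtE (bigD1 i) //= big1 ?mxE ?eqxx ?oner_eq0 // => j ji.
  by rewrite mxE (negPf ji) andbF eqxx.
have e_dual : ~ e \in dual_code C by move=> /dC.
apply: contrapT => noc; apply: e_dual.
rewrite inE; apply/forallP => c; apply/implyP => Cc.
rewrite (bigD1 i) //= big1 => [|j ji]; last first.
  by rewrite mxE (negPf ji) andbF mul0r.
rewrite addr0 mxE !eqxx mul1r.
by apply: contrapT => /negP ci; apply: noc; exists c.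
Qed.

(* Translation by multiples of [c0] permutes the level sets of coordinate [i]. *)
Lemma card_coord_fiber C c0 i : c0 \in C -> c0 ord0 i != 0 ->
  #|C| = (#|F| * \sum_(c in C) (c ord0 i == 0%R))%N.
Proof.
move=> Cc0 c0i.
rewrite -sum1_card (partition_big (fun c => c ord0 i) predT) //=.
rewrite -sum_nat_const; apply: eq_bigr => a _.
rewrite (reindex_inj (addIr ((a / c0 ord0 i) *: c0))) /=.
rewrite [RHS]big_mkcond [LHS]big_mkcond; apply: eq_bigr => c _.
rewrite rpredDr ?rpredZ // !mxE divfK // -[X in _ == X]add0r (inj_eq (addIr a)).
by case: (c \in C) => //=; case: (_ == _).
Qed.

(** The zero level is one of [#|F|] equal parts of [C], and nonzero values fill the others; the
    factor [#|F|] on the left avoids dividing in [nat]. *)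
Lemma sum_coord_neq0 C i : dual_distance_ge2 C ->
  (#|F| * \sum_(c in C) (c ord0 i != 0%R))%N = (#|C| * (#|F| - 1))%N.
Proof.
move=> /(@dual_distance_ge2_coord C i) [c0 Cc0 c0i].
have cardE := card_coord_fiber Cc0 c0i.
have : (\sum_(c in C) (c ord0 i == 0%R) + \sum_(c in C) (c ord0 i != 0%R))%N = #|C|.
  by rewrite -big_split -sum1_card; apply: eq_bigr => c _; case: (_ == _).
by move=> splitC; nia.
Qed.

Lemma sum_wt C : dual_distance_ge2 C ->
  (#|F| * \sum_(c in C) wt c = n * (#|C| * (#|F| - 1)))%N.
Proof.
move=> dC; under eq_bigr do rewrite wtE.
rewrite exchange_big big_distrr /=.
under eq_bigr do rewrite (sum_coord_neq0 _ dC).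
by rewrite sum_nat_const card_ord.
Qed.

Lemma sum_wt_le C : (\sum_(c in C) wt c <= (#|C| - 1) * diameter C)%N.
Proof.
rewrite (bigD1 0) ?mem0v //= wt0 add0n (cardD1 0 C) mem0v add1n subn1 /=.
rewrite -sum_nat_const (eq_bigl (mem [predD1 C & 0])); last first.
  by move=> c; rewrite !inE andbC.
by apply: leq_sum => c; rewrite !inE => /andP[_]; apply: wt_le_diameter.
Qed.

Lemma length_diameter_bound C : dual_distance_ge2 C ->
  (n * (#|F| ^ \dim C * (#|F| - 1)) <= #|F| * ((#|F| ^ \dim C - 1) * diameter C))%N.
Proof.
by move=> dC; rewrite -(card_vspace C) -sum_wt // leq_mul2l sum_wt_le orbT.
Qed.

End WeightCount.

Theorem corollary4p8 (R : realType) (q : nat) (F : finFieldType)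
    (hq : #|F| = q) (n k delta : nat) (hn : (0 < n)%N)
    (C : {vspace 'rV[F]_n}) (hk : \dim C = k)
    (hdual : dual_distance_ge2 C) (hdelta : diameter C = delta) :
  [/\ n%:R <= (if (q - 1 %| delta)%N
               then q%:R / (q%:R - 1) * delta%:R - 1
               else (Num.floor (q%:R / (q%:R - 1) * delta%:R : R))%:~R) :> R,
      q = 2%N -> n%:R <= 2%:R * delta%:R - 1 :> R
    & k%:R >= logb q%:R (delta%:R / (delta%:R - n%:R * (1 - 1 / q%:R))) :> R].
Proof.
have bound := length_diameter_bound hdual.
rewrite hq hk hdelta in bound.
have q_gt1 : (1 < q)%N by rewrite -hq finNzRing_gt1.
have Q_gt0 : (0 < q ^ k)%N by rewrite expn_gt0; lia.
(* With diameter 0, [bound] would make a product of positive numbers, among them [n], vanish. *)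
have delta_gt0 : (0 < delta)%N.
  rewrite lt0n; apply/eqP => d0; move: bound.
  by rewrite d0 !muln0 leqn0 !muln_eq0; lia.
(* Replacing [q ^ k - 1] by [q ^ k] in [bound] makes it strict, as [delta] is positive; then [q ^ k]
   cancels. *)
have lt_nd : (n * (q - 1) < q * delta)%N.
  rewrite -(ltn_pmul2r Q_gt0); apply: leq_ltn_trans (_ : q * ((q ^ k - 1) * delta) < _)%N.
    by rewrite -mulnA [((q - 1) * _)%N]mulnC.
  by rewrite -mulnA ltn_mul2l [(delta * _)%N]mulnC ltn_mul2r; lia.
have qR_gt1 : 1 < q%:R :> R by rewrite ltr1n.
have qR1_gt0 : 0 < q%:R - 1 :> R by rewrite subr_gt0.
have natq1 : (q - 1)%:R = q%:R - 1 :> R by rewrite natrB // ltnW.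
have first : n%:R <= (if (q - 1 %| delta)%N
               then q%:R / (q%:R - 1) * delta%:R - 1
               else (Num.floor (q%:R / (q%:R - 1) * delta%:R : R))%:~R) :> R.
  (* If [delta = m * (q - 1)], the right side is the integer [q * m], and strictness yields the
     extra [- 1]. Otherwise the weak inequality suffices, since an integer below a real is below its
     floor. *)
  case: ifPn => [/dvdnP[m deltaE]|_].
    have lt_n : (n < q * m)%N.
      by move: lt_nd; rewrite deltaE mulnA ltn_mul2r => /andP[].
    have -> : q%:R / (q%:R - 1) * delta%:R = (q * m)%:R :> R.
      by rewrite deltaE !natrM natq1; field; rewrite gt_eqF.
    by rewrite lerBrDr natr1 ler_nat.
  rewrite -[n%:R]/(n%:Z%:~R) ler_int floor_ge_int /=.
  rewrite mulrAC ler_pdivlMr // -natq1 -[n%:~R]/(n%:R) -!natrM ler_nat.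
  exact: ltnW.
split=> // [q2|].
  (* For [q = 2] the divisor [q - 1] is 1, so the divisible case always applies. *)
  by move: first; rewrite q2 subSS subn0 dvd1n (_ : 2%:R - 1 = 1) ?divr1 //; ring.
have lnq_gt0 : 0 < ln q%:R :> R by rewrite ln_gt0.
have dR_gt0 : 0 < delta%:R :> R by rewrite ltr0n.
have QR_gt0 : 0 < (q ^ k)%:R :> R by rewrite ltr0n.
(* This is [bound] divided by [q * q ^ k]. Its left side is positive, so the argument of [logb] is
   positive and the default value of [ln] never enters. *)
have gap : delta%:R / (q ^ k)%:R <= delta%:R - n%:R * (1 - 1 / q%:R) :> R.
  have : (n * (q ^ k * (q - 1)))%:R <= (q * ((q ^ k - 1) * delta))%:R :> R.
    by rewrite ler_nat.
  rewrite !natrM natq1 natrB // => boundR.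
  rewrite ler_pdivrMr // -(ler_pM2l (lt_trans ltr01 qR_gt1)) -subr_ge0.
  rewrite (_ : _ - _ = q%:R * (((q ^ k)%:R - 1%:R) * delta%:R)
      - n%:R * ((q ^ k)%:R * (q%:R - 1)) :> R) ?subr_ge0 //.
  by field; rewrite gt_eqF // (lt_trans ltr01).
have gap_gt0 : 0 < delta%:R - n%:R * (1 - 1 / q%:R) :> R.
  by apply: lt_le_trans gap; rewrite divr_gt0.
(* As [ln] is increasing, the claim reduces to the quotient being at most [q ^ k], a rearrangement
   of [gap]. *)
rewrite /logb ler_pdivrMr // [k%:R * _]mulr_natl -lnXn ?(lt_trans ltr01) // -natrX.
rewrite ler_ln ?posrE ?divr_gt0 //.
by rewrite ler_pdivrMr // mulrC -ler_pdivrMr.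
Qed.
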